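(* Let $A$ be a finite alphabet and $L \subseteq A^*$ a language. The following conditions are equivalent: (1) $L$ is context-free. (2) There exist a finite set $X$, a map $(o,\delta): X \to \mathbb{B} \times \mathcal{P}_\omega(X^* )^A$ and an $x \in X$ such that $[\![ \{x\} ]\!] = L$, where $[\![ - ]\!]$ is taken with respect to the extension $(\mathcal{P}_\omega(X^* ), (\hat{o}, \hat{\delta}))$. (3) There exist a finite set $X$, a map $(o,\delta): X \to \mathbb{B} \times \mathcal{P}_\omega(X^* )^A$ and an $S \in \mathcal{P}_\omega(X^* )$ such that $[\![ S ]\!] = L$, with respect to the same extension.
   Context: $\mathbb{B}=\{0,1\}$ is the Boolean semiring; $\mathcal{P}_\omega(X^* )$ is the set of finite sets of words over $X$, with union and concatenation $ST=\{st \mid s\in S, t\in T\}$. Write $x_a := \delta(x)(a)$. Let $i:\mathbb{B}\to\mathcal{P}(X^* )$ be given by $i(1)=\{\epsilon\}$, $i(0)=\emptyset$. The extension $(\hat{o},\hat{\delta}): \mathcal{P}_\omega(X^* ) \to \mathbb{B}\times\mathcal{P}_\omega(X^* )^A$ (write $S_a := \hat{\delta}(S)(a)$) is defined inductively by: $\hat{o}(\{\epsilon\})=1$, $\{\epsilon\}_a=\emptyset$; for $x \in X$, $w\in X^*$: $\hat{o}(\{xw\}) = o(x)\wedge \hat{o}(\{w\})$ and $\{xw\}_a = x_a\{w\} \cup i(o(x))\{w\}_a$; for a finite set $S$: $\hat{o}(S)=\bigvee_{s\in S}\hat{o}(\{s\})$ and $S_a=\bigcup_{s\in S}\{s\}_a$.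 Word derivatives: $S_\epsilon=S$, $S_{aw}=(S_a)_w$. The set $\mathcal{P}(A^* )$ of all languages is the final $\mathbb{B}\times(-)^A$-coalgebra with $o(L)=1$ iff $\epsilon\in L$ and $L_a=\{w \mid aw\in L\}$; $[\![-]\!]:\mathcal{P}_\omega(X^* )\to\mathcal{P}(A^* )$ is the unique coalgebra homomorphism, explicitly $[\![S]\!]=\{w\in A^* \mid \hat{o}(S_w)=1\}$. A language is context-free if it is generated from some nonterminal by a context-free grammar with finitely many nonterminals and finitely many productions. *)

(* Defs.v *)
From mathcomp Require Export all_boot finmap boolp classical_sets.
From Stdlib Require Export Relation_Operators.

Set Implicit Arguments.
Unset Strict Implicit.
Unset Printing Implicit Defensive.

Local Open Scope classical_set_scope.
Local Open Scope fset_scope.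

Notation language A := (set (seq A)).

Definition coalgebra (A C : Type) := C -> bool * (A -> C).

Definition output (A C : Type) (c : coalgebra A C) (x : C) : bool := (c x).1.

Definition deriv (A C : Type) (c : coalgebra A C) (x : C) (a : A) : C :=
  (c x).2 a.

Fixpoint word_deriv (A C : Type) (c : coalgebra A C) (x : C) (w : seq A) : C :=
  if w is a :: w' then word_deriv c (deriv c x a) w' else x.

Definition homomorphism (A C D : Type) (c : coalgebra A C) (d : coalgebra A D)
    (f : C -> D) : Prop :=
  forall x, output d (f x) = output c x /\
    forall a, deriv d (f x) a = f (deriv c x a).

Definition lang_coalgebra (A : Type) : coalgebra A (language A) :=
  fun L => (`[< L [::] >], fun a => [set w | L (a :: w)]).

Definition semantics (A C : Type) (c : coalgebra A C) (x : C) : language A :=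
  [set w | output c (word_deriv c x w)].

(* [lang_coalgebra] is final, and [semantics] is the mediating map. *)
Lemma semantics_homomorphism (A C : Type) (c : coalgebra A C) :
  homomorphism c (@lang_coalgebra A) (semantics c).
Proof. by move=> x; split=> //; apply: asboolb. Qed.

Lemma semantics_unique (A C : Type) (c : coalgebra A C) (f : C -> language A) :
  homomorphism c (@lang_coalgebra A) f -> f = semantics c.
Proof.
move=> fhom; apply/funext => x; apply/seteqP.
suff fE w : f x w <-> semantics c x w by split=> w /fE.
elim: w x => [|a w IHw] x.
  have [fx _] := fhom x; rewrite /semantics /= -fx.
  by split=> /asboolP.
have [_ /(_ a) fa] := fhom x.
by have := IHw (deriv c x a); rewrite -fa.
Qed.

Definition fconcat (X : finType) (S T : {fset seq X}) : {fset seq X} :=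
  [fset s ++ t | s in S, t in T].

Definition fset_of_bool (X : finType) (b : bool) : {fset seq X} :=
  if b then [fset [::]] else fset0.

Section Extension.

Variables (A : Type) (X : finType) (c : X -> bool * (A -> {fset seq X})).

Fixpoint word_output (w : seq X) : bool :=
  if w is x :: w' then (c x).1 && word_output w' else true.

Fixpoint letter_deriv (w : seq X) (a : A) : {fset seq X} :=
  if w is x :: w' then
    fconcat ((c x).2 a) [fset w']
      `|` fconcat (fset_of_bool X (c x).1) (letter_deriv w' a)
  else fset0.

Definition extension : coalgebra A {fset seq X} := fun S =>
  (\big[orb/false]_(s <- S) word_output s,
   fun a => \bigcup_(s <- S) letter_deriv s a).

End Extension.

(* A production (n, alpha) stands for n -> alpha; in a sentential form,
   nonterminals are tagged by [inl] and terminals by [inr]. *)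
Definition grammar (A N : finType) := {fset N * seq (N + A)}.

Definition derives1 (A N : finType) (G : grammar A N)
    (u v : seq (N + A)) : Prop :=
  exists p s n alpha, [/\ (n, alpha) \in G,
    u = p ++ inl n :: s & v = p ++ alpha ++ s].

Definition derives (A N : finType) (G : grammar A N) :
  seq (N + A) -> seq (N + A) -> Prop := clos_refl_trans _ (derives1 G).

Definition generated (A N : finType) (G : grammar A N) (n : N) : language A :=
  [set w | derives G [:: inl n] [seq inr a | a <- w]].

Definition context_free (A : finType) (L : language A) : Prop :=
  exists (N : finType) (G : grammar A N) (n : N), generated G n = L.

(* Main.v *)
(** From a coalgebra to a grammar, [x -> a u] for [u] in [x_a] and [x -> epsilon]
    when [o x] holds. From a grammar to a coalgebra, no Greibach normal form is
    computed: write [u =>* s] for derivability over the symbols [u] of the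
    grammar, and take as letters the symbols [u], denoting
    [{w | u =>* w}], and the pairs [(u, v)], denoting [{w | u =>* v w}]. Then
    [u_a] is the single letter [(u, a)], and [(u, v)_a] consists of the words
    [(z, a) beta (u, p)] for the productions [p -> gamma z beta] with
    [gamma =>* v], where [p] is the lowest common ancestor of the leaves [v]
    and [a] in a parse tree of [u =>* v a w]. *)
Require Import Defs.

Set Implicit Arguments.
Unset Strict Implicit.
Unset Printing Implicit Defensive.

Local Open Scope classical_set_scope.
Local Open Scope fset_scope.

Lemma map_eq_cat (T U : Type) (f : T -> U) (w : seq T) (t1 t2 : seq U) :
  map f w = t1 ++ t2 ->
  exists w1 w2, [/\ w = w1 ++ w2, map f w1 = t1 & map f w2 = t2].
Proof.
move=> E; exists (take (size t1) w), (drop (size t1) w).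
by rewrite cat_take_drop map_take map_drop E take_size_cat ?drop_size_cat.
Qed.

(** * Extending languages of letters to words *)

Section WordLanguage.

Variables (A X : Type) (lang : X -> language A).

Fixpoint word_lang (s : seq X) : language A :=
  if s is x :: s' then
    [set w | exists w1 w2, [/\ w = w1 ++ w2, lang x w1 & word_lang s' w2]]
  else [set [::]].

Lemma word_lang_cat s t w :
  word_lang (s ++ t) w <->
  exists w1 w2, [/\ w = w1 ++ w2, word_lang s w1 & word_lang t w2].
Proof.
elim: s w => [|x s IHs] w /=.
  by split=> [tw|[w1 [w2 [-> -> //]]]]; exists [::], w.
split=> [[w1 [w2 [-> xw1 /IHs[w3 [w4 [-> sw3 tw4]]]]]]|].
  by exists (w1 ++ w3), w4; split; rewrite ?catA //; exists w1, w3.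
move=> [_ [w2 [-> [w3 [w4 [-> xw3 sw4]]] tw2]]].
exists w3, (w4 ++ w2); split; rewrite ?catA //.
by apply/IHs; exists w4, w2.
Qed.

Lemma word_lang1 x w : word_lang [:: x] w <-> lang x w.
Proof.
split=> [[w1 [_ [-> xw1 ->]]]|xw]; first by rewrite cats0.
by exists w, [::]; rewrite cats0.
Qed.

End WordLanguage.

(** * Solutions of the system of equations presented by a coalgebra *)

Section Solution.

Variables (A : Type) (X : finType) (c : X -> bool * (A -> {fset seq X})).

Lemma mem_letter_deriv_cons x s a t :
  t \in letter_deriv c (x :: s) a <->
  (exists2 u, u \in (c x).2 a & t = u ++ s) \/
  ((c x).1 /\ t \in letter_deriv c s a).
Proof.
rewrite /= in_fsetU; split=> [/orP[]|[[u ux ->]|[ox ts]]].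
- by case/imfset2P=> u /= ux [v]; rewrite inE => /eqP-> ->; left; exists u.
- case/imfset2P=> u /= + [v vs ->]; rewrite /fset_of_bool.
  by case: (c x).1; rewrite ?inE // => /eqP->; right.
- by apply/orP; left; apply/imfset2P; exists u => //=; exists s; rewrite ?inE.
- apply/orP; right; apply/imfset2P; exists [::]; last by exists t.
  by rewrite /= /fset_of_bool ox inE.
Qed.

(** The two hypotheses say that the family [lang] solves the equations given by [c], where a word
    over [X] is read as the concatenation of the languages of its letters. *)
Variable lang : X -> language A.
Hypothesis lang_nil : forall x, (c x).1 <-> lang x [::].
Hypothesis lang_cons : forall x a w,
  lang x (a :: w) <-> exists2 s, s \in (c x).2 a & word_lang lang s w.

Lemma word_outputP s : word_output c s <-> word_lang lang s [::].
Proof.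
elim: s => [|x s IHs] //=; split.
  by case/andP=> /lang_nil ? /IHs ?; exists [::], [::].
move=> [w1 [w2 []]]; case: w1 => //; case: w2 => // _.
by move=> /lang_nil-> /IHs->.
Qed.

Lemma letter_derivP s a w :
  word_lang lang s (a :: w) <->
  exists2 t, t \in letter_deriv c s a & word_lang lang t w.
Proof.
elim: s w => [|x s IHs] w; first by split=> // -[t]; rewrite inE.
split=> [[[|b w1] [w2 [/= Ew xw1 sw2]]]|].
- move: sw2; rewrite -Ew => /IHs[t ts tw]; exists t => //.
  by apply/mem_letter_deriv_cons; right; split=> //; apply/lang_nil.
- case: Ew xw1 => <- -> /lang_cons[u ux uw1]; exists (u ++ s).
    by apply/mem_letter_deriv_cons; left; exists u.
  by apply/word_lang_cat; exists w1, w2.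
move=> [t /mem_letter_deriv_cons[[u ux ->]|[/lang_nil ox ts]]].
  case/word_lang_cat=> w1 [w2 [-> uw1 sw2]]; exists (a :: w1), w2; split=> //.
  by apply/lang_cons; exists u.
by move=> tw; exists [::], (a :: w); split=> //; apply/IHs; exists t.
Qed.

(** By finality: the union of the word languages over [S] is a homomorphism from the extension,
    hence equals [semantics]. Each construction below thus only has to exhibit a solution. *)
Lemma semantics_extension S :
  semantics (extension c) S = [set w | exists2 s, s \in S & word_lang lang s w].
Proof.
pose f (S : {fset seq X}) : language A :=
  [set w | exists2 s, s \in S & word_lang lang s w].
rewrite -[RHS]/(f S) -(_ : f = semantics (extension c)) //.
apply: semantics_unique => {}S; split=> [|a].
  rewrite /output /= big_has; apply/asboolP/hasP=> -[s sS].
    by move/word_outputP; exists s.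
  by move/word_outputP; exists s.
apply/seteqP; split=> w; rewrite /deriv /=.
  move=> [s sS /letter_derivP[t ts tw]]; exists t => //.
  by apply/bigfcupP; exists s; rewrite ?sS.
move=> [t /bigfcupP[s /andP[sS _] ts] tw]; exists s => //.
by apply/letter_derivP; exists t.
Qed.

End Solution.

(** * Derivations as parse forests *)

Section Yields.

Variables (A N : finType) (G : grammar A N).
Implicit Types (s t : seq (N + A)) (w : seq A).

(** Parse forests with roots [s] and leaves [t], in contrast to the step sequences of [derives];
    they allow induction along the trees. A nonterminal may stay as a leaf, which the pairs [(u, p)]
    require. *)
Inductive yields : seq (N + A) -> seq (N + A) -> Prop :=
| yields_nil : yields [::] [::]
| yields_keep v s t : yields s t -> yields (v :: s) (v :: t)
| yields_step n alpha s t1 t2 :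
    (n, alpha) \in G -> yields alpha t1 -> yields s t2 ->
    yields (inl n :: s) (t1 ++ t2).

Lemma yields_refl s : yields s s.
Proof. by elim: s => [|v s]; constructor. Qed.

Lemma yields_cat s1 s2 t1 t2 :
  yields s1 t1 -> yields s2 t2 -> yields (s1 ++ s2) (t1 ++ t2).
Proof.
move=> y1 y2; elim: y1 => [|v s t _ IH|n al s t t' nG yal _ _ IH] //=.
  by constructor.
by rewrite -catA; apply: yields_step nG yal IH.
Qed.

Lemma yields_catI s1 s2 t : yields (s1 ++ s2) t ->
  exists t1 t2, [/\ t = t1 ++ t2, yields s1 t1 & yields s2 t2].
Proof.
elim: s1 t => [|v s1 IHs] t /= yt.
  by exists [::], t; split=> //; constructor.
inversion yt as [|v' s' t' yt'|n al s' t1 t2 nG yal ys]; subst.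
  have [t1 [t2 [-> y1 y2]]] := IHs _ yt'.
  by exists (v :: t1), t2; split=> //; constructor.
have [t3 [t4 [-> y3 y4]]] := IHs _ ys.
by exists (t1 ++ t3), t4; split; rewrite ?catA //; apply: yields_step nG yal y3.
Qed.

Lemma yieldsP s t : derives G s t <-> yields s t.
Proof.
split=> [st|].
  have: yields t t by apply: yields_refl.
  (* Generalised to: if [t] yields [t'], so does [s]. A rewriting step is then absorbed at the roots
     of a forest. *)
  move: {2 3}t => t'; elim: st t' => {s t} [s t st t'|//|s t u _ IHs _ IHt t'].
    case: st => p [q [n [al [nG -> ->]]]].
    case/yields_catI=> t1 [_ [-> y1 /yields_catI[t2 [t3 [-> y2 y3]]]]].
    by apply: yields_cat => //; apply: yields_step nG y2 y3.
  by move=> /IHt /IHs.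
have ctx p q s' t' : derives G s' t' -> derives G (p ++ s' ++ q) (p ++ t' ++ q).
  elim=> {s' t'} [s' t' [p' [q' [n [al [nG -> ->]]]]]|s'|s' t' u _ IHs _ IHt].
  - apply: rt_step; exists (p ++ p'), (q' ++ q), n, al.
    by rewrite -!catA /= -?catA.
  - exact: rt_refl.
  - exact: rt_trans IHs IHt.
elim=> {s t} [|v s t _ IH|n al s t1 t2 nG _ IH1 _ IH2]; first exact: rt_refl.
  by have := ctx [:: v] [::] _ _ IH; rewrite !cats0.
apply: (@rt_trans _ _ _ (al ++ s)).
  by apply: rt_step; exists [::], s, n, al.
apply: rt_trans (ctx [::] s _ _ IH1) _.
by have := ctx t1 [::] _ _ IH2; rewrite !cats0.
Qed.

Lemma yields_trans s t u : yields s t -> yields t u -> yields s u.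
Proof. move=> /yieldsP st /yieldsP tu; apply/yieldsP; exact: rt_trans st tu. Qed.

Definition form_lang s : language A := [set w | yields s [seq inr a | a <- w]].

Lemma form_lang_nil w : form_lang [::] w <-> w = [::].
Proof.
split=> [|->]; last exact: yields_nil.
by case: w => // b w y; inversion y.
Qed.

Lemma form_lang_cat s t w :
  form_lang (s ++ t) w <->
  exists w1 w2, [/\ w = w1 ++ w2, form_lang s w1 & form_lang t w2].
Proof.
split=> [/yields_catI[t1 [t2 [/map_eq_cat[w1 [w2 [-> <- <-]]] y1 y2]]]|].
  by exists w1, w2.
move=> [w1 [w2 [-> y1 y2]]]; rewrite /form_lang /= map_cat.
exact: yields_cat.
Qed.

(** Serves both constructions: [f] is the identity when letters are built from symbols, [g] when
    symbols are built from letters. *)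
Lemma word_lang_map (X Y : Type) (lang : X -> language A) (g : Y -> X)
    (f : Y -> N + A) (s : seq Y) w :
  (forall y, lang (g y) = form_lang [:: f y]) ->
  word_lang lang (map g s) w <-> form_lang (map f s) w.
Proof.
move=> langE; elim: s w => [|y s IHs] w; first exact: iff_sym (form_lang_nil w).
rewrite /= -cat1s; split=> [|/form_lang_cat] [w1 [w2 [-> y1 y2]]].
  by apply/form_lang_cat; exists w1, w2; split=> //; [rewrite -langE|apply/IHs].
by exists w1, w2; split=> //; [rewrite langE|apply/IHs].
Qed.

Lemma form_lang_inl n w : form_lang [:: inl n] w <->
  exists2 alpha, (n, alpha) \in G & form_lang alpha w.
Proof.
split=> [y|[al nG y]]; last first.
  by rewrite /form_lang /= -[map _ w]cats0; apply: yields_step nG y yields_nil.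
inversion y as [|v s t _ E1 E2|n' al s t1 t2 nG yal ys E1 E2].
  by case: w y E2.
exists al => //; inversion ys; subst.
by rewrite /form_lang /= -E2 cats0.
Qed.

Lemma yields_inr_cons b s t :
  yields (inr b :: s) t -> exists2 t', t = inr b :: t' & yields s t'.
Proof. by move=> y; inversion y as [|v s' t' y'|]; exists t'. Qed.

(** The root [z] is the one above the leaf [a]; all roots to its left derive the empty word. *)
Lemma form_lang_first s a w : form_lang s (a :: w) ->
  exists s1 z s2 w1 w2, [/\ s = s1 ++ z :: s2, yields s1 [::],
    form_lang [:: z] (a :: w1), form_lang s2 w2 & w = w1 ++ w2].
Proof.
elim: s => [|z s IHs]; first by move/form_lang_nil.
rewrite -cat1s => /form_lang_cat[[|b w1] [w2 [/= E y1 y2]]]; last first.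
  by case: E y1 => <- -> y1; exists [::], z, s, w1, w2; split=> //; constructor.
move: y2; rewrite -E => /IHs[s1 [z' [s2 [w3 [w4 [-> y3 y4 y5 ->]]]]]].
exists (z :: s1), z', s2, w3, w4; split=> //.
by rewrite -cat1s -[[::]]/([::] ++ [::]); apply: yields_cat.
Qed.

(* [split_lang s v a w] says that the leaves [v] and [a] of a parse forest of
   [s =>* v a w] sit below distinct roots. *)
Definition split_lang s v a w := exists s1 z s2 w1 w2,
  [/\ s = s1 ++ z :: s2, yields s1 [:: v], form_lang [:: z] (a :: w1),
      form_lang s2 w2 & w = w1 ++ w2].

(** Induction on the forest. It is stated for several roots because the children of a node form a
    forest; the second alternative is the case of a common ancestor [p], with [alpha] its
    children. *)
Lemma yields_common_ancestor s v a w :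
  yields s (v :: inr a :: [seq inr b | b <- w]) ->
  split_lang s v a w \/
  exists p alpha w1 w2, [/\ (p, alpha) \in G, split_lang alpha v a w1,
    yields s (inl p :: [seq inr b | b <- w2]) & w = w1 ++ w2].
Proof.
move Et: (v :: _) => t y; elim: y w Et => {s t} [//|u s t y _ w|].
  case=> -> Et; left; move: y; rewrite -Et => /(@form_lang_first _ a w).
  move=> [s1 [z [s2 [w1 [w2 [-> y1 y2 y3 ->]]]]]].
  by exists (u :: s1), z, s2, w1, w2; split=> //; constructor.
move=> n al s t1 t2 nG yal IHal ys IHs w.
(* The first tree carries neither of the leaves [v] and [a], only [v], or both. *)
case: t1 yal IHal => [|v' [|b t1]] yal IHal /=.
- move=> Et; case: (IHs _ Et) => [[s1 [z [s2 [w1 [w2 [-> y1 y2 y3 ->]]]]]]|].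
    left; exists (inl n :: s1), z, s2, w1, w2; split=> //.
    exact: yields_step nG yal y1.
  move=> [p [be [w1 [w2 [pG yp y ->]]]]].
  by right; exists p, be, w1, w2; split=> //; apply: yields_step nG yal y.
- case=> Ev Et; left; move: yal ys; rewrite -Ev -Et => yal.
  move=> /(@form_lang_first _ a w)[s1 [z [s2 [w1 [w2 [-> y1 y2 y3 ->]]]]]].
  exists (inl n :: s1), z, s2, w1, w2; split=> //.
  exact: (yields_step nG yal y1).
case=> Ev Eb /map_eq_cat[w1 [w2 [Ew E1 E2]]]; right.
(* If [al] already separates the two leaves, the ancestor is the root [n] itself, kept as a leaf
   above; otherwise it lies deeper in the tree. *)
have [||yp] := IHal w1; first by rewrite Ev Eb E1.
  exists n, al, w1, w2; split=> //.
  by rewrite E2; constructor.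
move: yp => [p [be [w3 [w4 [pG yp y E]]]]].
exists p, be, w3, (w4 ++ w2); split; rewrite ?catA -?E //.
by rewrite map_cat E2; apply: (yields_step nG y ys).
Qed.

End Yields.

(** * From a grammar to a coalgebra *)

Section GrammarToCoalgebra.

Variables (A N : finType) (G : grammar A N).

Definition corner : finType := ((N + A) + (N + A) * (N + A))%type.

(** From left to right, the letters produce what follows [a] below [z], then what lies below [beta],
    then what lies to the right of [p] in the tree of [u]. *)
Definition corner_word (u : N + A) (a : A) (p : N) (s : seq (N + A)) :
    seq corner :=
  if s is z :: beta then
    inr (z, inr a) :: [seq inl y | y <- beta] ++ [:: inr (u, inl p)]
  else [::].

(** A choice of production together with the position [i] of [z] in it, so [gamma] is the part
    before [i]. The bound on [i] ensures that [z] exists. *)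
Definition corner_words (u v : N + A) (a : A) : seq (seq corner) :=
  [seq corner_word u a pi.1 (drop i pi.2) | pi <- G,
     i <- [seq i <- iota 0 (size pi.2) | `[< yields G (take i pi.2) [:: v] >]]].

Definition corner_coalgebra (x : corner) : bool * (A -> {fset seq corner}) :=
  match x with
  | inl u => (`[< yields G [:: u] [::] >], fun a => [fset [:: inr (u, inr a)]])
  | inr (u, v) => (`[< yields G [:: u] [:: v] >],
                   fun a => [fset s | s in corner_words u v a])
  end.

Definition corner_lang (x : corner) : language A :=
  match x with
  | inl u => form_lang G [:: u]
  | inr (u, v) => [set w | yields G [:: u] (v :: [seq inr a | a <- w])]
  end.

Lemma mem_corner_words u v a s : s \in corner_words u v a <->
  exists p gamma z beta, [/\ (p, gamma ++ z :: beta) \in G,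
    yields G gamma [:: v] & s = corner_word u a p (z :: beta)].
Proof.
split=> [/allpairsPdep[[p al] [i [pG /= + ->]]]|].
  rewrite mem_filter mem_iota /= => /andP[/asboolP y ltial].
  case E: (drop i al) => [|z be].
    by move/eqP: E; rewrite -size_eq0 size_drop subn_eq0 leqNgt ltial.
  by exists p, (take i al), z, be; rewrite -E cat_take_drop /= E.
move=> [p [ga [z [be [pG y ->]]]]]; apply/allpairsPdep.
exists (p, ga ++ z :: be), (size ga); split=> //=; last by rewrite drop_size_cat.
rewrite mem_filter mem_iota take_size_cat //= size_cat /= addnS ltnS leq_addr.
by rewrite andbT; apply/asboolP.
Qed.

(** For a symbol, both sides are the same derivation. For a pair, cut the tree at the lowest common
    ancestor of [v] and [a], and conversely graft the production there. *)
Lemma corner_lang_cons x a w : corner_lang x (a :: w) <->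
  exists2 s, s \in (corner_coalgebra x).2 a & word_lang corner_lang s w.
Proof.
case: x => [u|[u v]]; split.
- move=> y; exists [:: inr (u, inr a)]; first by rewrite inE.
  by apply/word_lang1.
- by case=> s; rewrite inE => /eqP-> /word_lang1.
- case/yields_common_ancestor=> [|[p [al [w1 [w2 [pG yal yp ->]]]]]].
    (* The leaves [v] and [a] cannot have distinct roots when [u] is the only root. *)
    case=> [[|y s1] [z [s2 [w1 [w2 [E y1 y2 y3 ->]]]]]]; first by inversion y1.
    by case: s1 E y1.
  case: yal => ga [z [be [w3 [w4 [Eal yga yz ybe ->]]]]].
  exists (corner_word u a p (z :: be)).
    by rewrite in_fset; apply/mem_corner_words; exists p, ga, z, be; rewrite -Eal.
  exists w3, (w4 ++ w2); split=> //; first by rewrite catA.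
  apply/word_lang_cat; exists w4, w2; split=> //; last exact/word_lang1.
  by apply/(word_lang_map (f := id)) => //; rewrite map_id.
case=> s; rewrite in_fset => /mem_corner_words[p [ga [z [be [pG yga ->]]]]].
move=> [w1 [_ [-> yz /word_lang_cat[w2 [w3 [-> + /word_lang1 yu]]]]]].
move/(word_lang_map (G := G) (f := id)); rewrite map_id => /(_ (fun=> erefl)) ybe.
(* Derive [p] followed by [w3] from [u], then expand [p]: [ga] gives [v], [z] gives [a] and [w1],
   and [be] gives [w2]. *)
apply: yields_trans yu _.
have -> : v :: [seq inr b | b <- a :: w1 ++ w2 ++ w3] =
    (([:: v] ++ (inr a :: map inr w1) ++ map inr w2) ++ [::]) ++ map inr w3.
  by rewrite /= !map_cat cats0 -catA.
rewrite -cat1s; apply: yields_cat (yields_refl _ _).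
apply: (yields_step pG _ (yields_nil G)).
by apply: yields_cat yga _; rewrite -cat1s; apply: yields_cat.
Qed.

Lemma context_free_coalgebra (n : N) :
  semantics (extension corner_coalgebra) [fset [:: inl (inl n)]]
    = generated G n.
Proof.
rewrite (@semantics_extension _ _ _ corner_lang); last exact: corner_lang_cons.
  apply/seteqP; split=> w.
    by case=> s; rewrite inE => /eqP-> /word_lang1 /yieldsP.
  move=> /yieldsP y; exists [:: inl (inl n)]; first by rewrite inE.
  exact/word_lang1.
by case=> [u|[u v]]; split=> /asboolP.
Qed.

End GrammarToCoalgebra.

(** * From a coalgebra to a grammar *)

Section CoalgebraToGrammar.

Variables (A X : finType) (c : X -> bool * (A -> {fset seq X})).
Variable S : {fset seq X}.

Definition nonterminals (s : seq X) : seq (option X + A) :=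
  [seq inl (Some x) | x <- s].

(** [None] is a fresh start symbol, which turns the finite set [S] into productions of a single
    nonterminal. *)
Definition coalgebra_grammar : grammar A (option X) :=
  [fset pi in [seq (None, nonterminals s) | s <- S] ++
     [seq (Some x, [::]) | x <- enum X & (c x).1] ++
     [seq (Some xa.1, inr xa.2 :: nonterminals s)
        | xa <- enum {: X * A}, s <- (c xa.1).2 xa.2]].

Lemma coalgebra_grammar_None alpha : (None, alpha) \in coalgebra_grammar <->
  exists2 s, s \in S & alpha = nonterminals s.
Proof.
rewrite in_fset !mem_cat; split=> [/or3P[]|[s sS ->]].
- by case/mapP=> s sS [->]; exists s.
- by case/mapP.
- by case/allpairsPdep=> ? [? [_ _]].
- by rewrite map_f.
Qed.

Lemma coalgebra_grammar_Some x alpha : (Some x, alpha) \in coalgebra_grammar <->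
  ((c x).1 /\ alpha = [::]) \/
  exists a s, s \in (c x).2 a /\ alpha = inr a :: nonterminals s.
Proof.
rewrite in_fset !mem_cat; split=> [/or3P[]|[[ox ->]|[a [s [sx ->]]]]].
- by case/mapP.
- by case/mapP=> y; rewrite mem_filter => /andP[oy _] [-> ->]; left.
- case/allpairsPdep=> -[y a] [s [_ /= sy [-> ->]]].
  by right; exists a, s.
- by rewrite orbCA map_f // mem_filter ox mem_enum.
apply/or3P/Or33; apply/allpairsPdep; exists (x, a), s.
by rewrite mem_enum.
Qed.

(** The languages of the nonterminals [Some x] solve the equations of [c]: their productions are
    empty or start with a terminal, so the first letter of a word fixes the derivative used. *)
Lemma coalgebra_context_free :
  generated coalgebra_grammar None = semantics (extension c) S.
Proof.
pose lang x := form_lang coalgebra_grammar [:: inl (Some x)].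
have langE s w :
    word_lang lang s w <-> form_lang coalgebra_grammar (nonterminals s) w.
  by rewrite -{1}[s]map_id; apply: word_lang_map.
rewrite (@semantics_extension _ _ _ lang) => [|x|x a w].
- apply/seteqP; split=> w.
    case/yieldsP/form_lang_inl=> _ /coalgebra_grammar_None[s sS ->].
    by move/langE; exists s.
  move=> [s sS /langE ys]; apply/yieldsP/form_lang_inl.
  by exists (nonterminals s) => //; apply/coalgebra_grammar_None; exists s.
- split=> [ox|/form_lang_inl[al]].
    apply/form_lang_inl; exists [::]; last exact: yields_nil.
    by apply/coalgebra_grammar_Some; left.
  by case/coalgebra_grammar_Some=> [[]//|[a [s [_ ->]]] /yields_inr_cons[]].
split=> [/form_lang_inl[al]|[s sx /langE ys]].
  case/coalgebra_grammar_Some=> [[_ ->] /form_lang_nil//|[b [s [sx ->]]]].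
  by case/yields_inr_cons=> t [-> <-] /langE ys; exists s.
apply/form_lang_inl; exists (inr a :: nonterminals s).
  by apply/coalgebra_grammar_Some; right; exists a, s.
exact: yields_keep.
Qed.

End CoalgebraToGrammar.

Theorem theorem3p8 (A : finType) (L : language A) :
  [<-> context_free L;
       exists (X : finType) (c : X -> bool * (A -> {fset seq X})) (x : X),
         semantics (extension c) [fset [:: x]]%fset = L;
       exists (X : finType) (c : X -> bool * (A -> {fset seq X}))
              (S : {fset seq X}),
         semantics (extension c) S = L].
Proof.
tfae.
- move=> [N [G [n <-]]].
  exists (corner A N), (corner_coalgebra G), (inl (inl n)).
  exact: context_free_coalgebra.
- by move=> [X [c [x <-]]]; exists X, c, [fset [:: x]].
move=> [X [c [S <-]]].
exists (option X), (coalgebra_grammar c S), None.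
exact: coalgebra_context_free.
Qed.
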